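(* Let $A=(a_{mn})_{m,n\ge0}$ be the infinite Gram matrix with entries $a_{mn}=\int_{\mathbb{R}}\psi_m(v)\psi_n(v)\,dv$. The inverse Gram matrix $A^{-1}$ admits a decomposition of the form $$A^{-1}=Z\,D^{-1}\,Z^\top ,$$ where $Z$ is the Gram kernel matrix and $D=\operatorname{diag}\left(2^{-m-\frac12}\right)_{m\ge0}$.
   Context: $\mathbb{N}$ contains $0$, so $2\mathbb{N}=\{0,2,4,\dots\}$. $T>0$ is fixed and $\psi_n(v)=\left(2^n n!\sqrt{\pi T}\right)^{-1/2}H_n\!\left(\frac{v}{\sqrt T}\right)e^{-v^2/T}$ for $n\in\mathbb{N}$, where $H_n$ is the (physicists') Hermite polynomial of degree $n$, with positive leading coefficient and $\int_{\mathbb{R}}H_nH_m e^{-v^2}\,dv=\sqrt{\pi}\,2^m m!\,\delta_{n,m}$. The Gram kernel matrix $Z=(z_{mn})_{m,n\ge0}$ is the upper triangular infinite matrix with $z_{mn}=\sqrt{\frac{n!}{m!}}\,\frac{1}{4^{\frac{n-m}{2}}\left(\frac{n-m}{2}\right)!}$ if $n-m\in2\mathbb{N}$ and $z_{mn}=0$ otherwise. The matrix $A$ has the Cholesky decomposition $A=LDL^\top$, where $L=(l_{nm})_{n,m\ge0}$ is the unit lower triangular infinite matrix with $l_{nm}=(-1)^{\frac{n-m}{2}}\sqrt{\frac{n!}{m!}}\,\frac{1}{4^{\frac{n-m}{2}}\left(\frac{n-m}{2}\right)!}$ if $n-m\in2\mathbb{N}$ and $l_{nm}=0$ otherwise, and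 $ZL^\top=L^\top Z=I$ (the infinite identity matrix). The inverse $A^{-1}$ is taken as $(LDL^\top)^{-1}=(L^\top)^{-1}D^{-1}L^{-1}$. The identity is to be read as an identity of quadratic forms on finitely supported sequences. It should not be interpreted as a bounded operator identity on $\ell^2$; indeed $D^{-1}$ grows exponentially and is not bounded. *)

(* Defs.v *)
From HB Require Import structures.
From mathcomp Require Import all_boot all_order all_algebra.
From mathcomp Require Import all_classical all_reals all_analysis.
Import Order.TTheory GRing.Theory Num.Theory.
Import numFieldNormedType.Exports.

Set Implicit Arguments.
Unset Strict Implicit.
Unset Printing Implicit Defensive.

Local Open Scope classical_set_scope.
Local Open Scope ring_scope.

Section Hermite.
Variable R : realType.

(* Rodrigues' formula H_n(x) = (-1)^n e^{x^2} (d/dx)^n e^{-x^2}, one derivative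
   at a time: H_{n+1} e^{-x^2} = - (H_n e^{-x^2})'. *)
Fixpoint hermite (n : nat) : {poly R} :=
  if n is n'.+1 then 2%:P * 'X * hermite n' - (hermite n')^`() else 1.

(* The exponent -v^2/T is the full Gaussian weight (not its square root), so
   the psi T n are not orthogonal. *)
Definition psi (T : R) (n : nat) (v : R) : R :=
  (2 ^+ n * n`!%:R * Num.sqrt (pi * T)) `^ (- 2^-1)
  * (hermite n).[v / Num.sqrt T] * expR (- (v ^+ 2 / T)).

End Hermite.

Section InfiniteMatrices.
Variable R : realType.

Definition imatrix := nat -> nat -> R.

(* The sums below are finitely supported sums over nat (0 by convention when
   infinitely many terms are nonzero).  They are only used for triangular
   matrices and finitely supported sequences, where all sums are finite. *)
Definition imul (A B : imatrix) : imatrix :=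
  fun i k => \sum_(j \in [set: nat]) (A i j * B j k).

Definition iapp (A : imatrix) (x : nat -> R) : nat -> R :=
  fun i => \sum_(j \in [set: nat]) (A i j * x j).

Definition itr (A : imatrix) : imatrix := fun i j => A j i.

Definition idiag (d : nat -> R) : imatrix := fun i j => d i *+ (i == j).

Definition iid : imatrix := idiag (fun=> 1).

Definition inverse_of (A B : imatrix) : Prop :=
  imul A B = iid /\ imul B A = iid.

Definition unit_lower_triangular (L : imatrix) : Prop :=
  (forall i, L i i = 1) /\ (forall i j, (i < j)%N -> L i j = 0).

Definition cholesky (A L : imatrix) (d : nat -> R) : Prop :=
  [/\ unit_lower_triangular L, forall k, 0 < d k
    & A = imul L (imul (idiag d) (itr L))].

Definition finitely_supported (x : nat -> R) : Prop :=
  \forall n \near \oo, x n = 0.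

(* The quadratic form x^T (U diag(d) W) x = <U^T x, diag(d) W x>.  It takes
   values in the extended reals: for U = Z, W = Z^T, d = D^{-1}, where all terms
   are nonnegative, the series diverges already at x = e_0, so the entries of the
   infinite matrix product U diag(d) W cannot be used. *)
Definition qform (U : imatrix) (d : nat -> R) (W : imatrix) (x : nat -> R) :
    \bar R :=
  (\sum_(0 <= k <oo) (iapp (itr U) x k * d k * iapp W x k)%:E)%E.

Definition gram (T : R) : imatrix :=
  fun m n => \int[lebesgue_measure]_(v in [set: R]) (psi T m v * psi T n v).

Definition gram_kernel : imatrix := fun m n =>
  if (m <= n)%N && ~~ odd (n - m) then
    Num.sqrt (n`!%:R / m`!%:R) * (4 ^+ (n - m)./2 * ((n - m)./2)`!%:R)^-1
  else 0.

Definition gram_L : imatrix := fun n m =>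
  if (m <= n)%N && ~~ odd (n - m) then
    (-1) ^+ (n - m)./2 *
    Num.sqrt (n`!%:R / m`!%:R) * (4 ^+ (n - m)./2 * ((n - m)./2)`!%:R)^-1
  else 0.

Definition gram_D (m : nat) : R := 2 `^ (- m%:R - 2^-1).

Definition gram_Dinv (m : nat) : R := (gram_D m)^-1.

End InfiniteMatrices.

Arguments iid {R}.

(* Main.v *)
(** Put u = v / sqrt T.  Integration by parts against exp (- 2 u^2) shows that the
    Gaussian integral Lambda kills 4 X p - p' for every polynomial p.  This
    determines Lambda (H_m H_n) up to the factor Lambda 1: it changes sign under
    (m + 1, n) -> (m, n + 1) and satisfies a two-step recursion in n for m = 0.
    The same relations hold for sqrt 2 ^ (m + n) <Q_m, Q_n>, where
    Q_n = exp (- (1/4) (d/dX)^2) X^n and the powers of X are orthogonal with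
    <X^k, X^k> = k! / 2^k.  Expanding <Q_m, Q_n> in coefficients is A = L D L^T, as
    L is the normalised coefficient matrix of the Q_n.  Z^T is the coefficient
    matrix of exp (+ (1/4) (d/dX)^2) X^n, hence the inverse of L. *)

Require Import Defs.
From HB Require Import structures.
From mathcomp Require Import all_boot all_order all_algebra.
From mathcomp Require Import all_classical all_reals all_analysis.
From mathcomp Require Import measurable_realfun ring.
Import Order.TTheory GRing.Theory Num.Theory.
Import numFieldNormedType.Exports.

Set Implicit Arguments.
Unset Strict Implicit.
Unset Printing Implicit Defensive.

Local Open Scope classical_set_scope.
Local Open Scope ring_scope.

(** * Infinite matrices *)

Section InfiniteMatrixTheory.
Variable R : realType.
Implicit Types A B C : imatrix R.

Definition lower_triangular A := forall i j, (i < j)%N -> A i j = 0.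

Lemma imulE (N : nat) A B i k :
  (forall j, (N <= j)%N -> A i j * B j k = 0) ->
  imul A B i k = \sum_(j < N) A i j * B j k.
Proof.
move=> AB0; rewrite (fsbig_ord _ _ (fun j => A i j * B j k)); apply/esym.
apply: fsbig_widen => // j [_ /=] /negP; rewrite -leqNgt; exact: AB0.
Qed.

Lemma iappE A (x : nat -> R) i : iapp A x i = imul A (fun j _ => x j) i 0%N.
Proof. by []. Qed.

Lemma itr_imul A B : itr (imul A B) = imul (itr B) (itr A).
Proof.
apply/funext => i; apply/funext => k; rewrite /itr /imul.
by apply: eq_fsbigr => j _; rewrite mulrC.
Qed.

Lemma itr_iid : itr (@iid R) = iid.
Proof.
by apply/funext => i; apply/funext => k; rewrite /itr /iid /idiag eq_sym.
Qed.

Lemma imul_diag (d : nat -> R) A i k : imul (idiag d) A i k = d i * A i k.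
Proof.
rewrite (imulE (N := i.+1)) => [|j ij]; last first.
  by rewrite /idiag (ltn_eqF ij) mul0r.
rewrite (bigD1 (ord_max : 'I_i.+1)) //= big1 ?addr0 /idiag ?eqxx // => j ji.
by rewrite (_ : (i == j) = false) ?mul0r // eq_sym; apply/negbTE.
Qed.

(* Since [R] has no zero divisors, the vanishing of the triple products outside
   a square makes the inner sum finite whenever its coefficient is nonzero. *)
Lemma imulA (N : nat) A B C i l :
  (forall j k, (N <= j)%N || (N <= k)%N -> A i j * B j k * C k l = 0) ->
  imul A (imul B C) i l = imul (imul A B) C i l.
Proof.
move=> ABC0.
have inl j : A i j * imul B C j l = \sum_(k < N) A i j * B j k * C k l.
  have [->|A0] := eqVneq (A i j) 0.
    by rewrite mul0r big1// => k _; rewrite !mul0r.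
  rewrite (imulE (N := N)) => [|k Nk].
    by rewrite mulr_sumr; apply: eq_bigr => k _; rewrite mulrA.
  by apply/(mulfI A0); rewrite mulr0 mulrA ABC0// Nk orbT.
have inr k : imul A B i k * C k l = \sum_(j < N) A i j * B j k * C k l.
  have [->|C0] := eqVneq (C k l) 0.
    by rewrite mulr0 big1// => j _; rewrite !mulr0.
  rewrite (imulE (N := N)) => [|j Nj]; first by rewrite mulr_suml.
  by apply/(mulIf C0); rewrite mul0r ABC0// Nj.
rewrite (imulE (N := N)) => [|j Nj]; last first.
  by rewrite inl big1// => k _; rewrite ABC0// Nj.
rewrite (imulE (N := N)) => [|k Nk]; last first.
  by rewrite inr big1// => j _; rewrite ABC0// Nk orbT.
under eq_bigr do rewrite inl.
by rewrite exchange_big; apply: eq_bigr => k _; rewrite inr.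
Qed.

(** In row i a nonzero term needs k <= j <= i, which bounds both summation indices. *)
Lemma imulA_lower A B C : lower_triangular A -> lower_triangular B ->
  imul A (imul B C) = imul (imul A B) C.
Proof.
move=> lA lB; apply/funext => i; apply/funext => l.
apply: (imulA (N := i.+1)) => j k ijk.
have [ij|ji] := ltnP i j; first by rewrite lA// !mul0r.
have jk : (j < k)%N.
  by move: ijk; rewrite ltnNge ji /=; exact: leq_ltn_trans.
by rewrite lB// mulr0 mul0r.
Qed.

Lemma imul1l A : imul iid A = A.
Proof. by apply/funext => i; apply/funext => k; rewrite imul_diag mul1r. Qed.

Lemma imul1r A : imul A iid = A.
Proof.
by rewrite -[A in LHS]/(itr (itr A)) -itr_iid -itr_imul imul1l.
Qed.

(** C = (B A) C = B (A C) = B, where triangularity of the two left factors justifies the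
    reassociation. *)
Lemma lower_right_inverse_unique A B C :
  lower_triangular A -> lower_triangular B -> imul B A = iid ->
  imul A C = iid -> C = B.
Proof.
move=> lA lB BA AC.
by rewrite -[LHS]imul1l -BA -imulA_lower// AC imul1r.
Qed.

Lemma iapp1 (x : nat -> R) : iapp iid x = x.
Proof. by apply/funext => i; rewrite iappE imul1l. Qed.

Lemma iapp_diag (d : nat -> R) (x : nat -> R) :
  iapp (idiag d) x = fun i => d i * x i.
Proof. by apply/funext => i; rewrite iappE imul_diag. Qed.

Lemma iapp_imul_lower A B (x : nat -> R) :
  lower_triangular A -> lower_triangular B ->
  iapp A (iapp B x) = iapp (imul A B) x.
Proof.
move=> lA lB; apply/funext => i.
by rewrite (iappE A) [in RHS]iappE -imulA_lower.
Qed.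

(** The row i bounds j and the support of x bounds k. *)
Lemma iapp_imul_lower_fs A B (x : nat -> R) :
  lower_triangular A -> finitely_supported x ->
  iapp A (iapp B x) = iapp (imul A B) x.
Proof.
move=> lA [N _ xN]; apply/funext => i.
rewrite (iappE A) [in RHS]iappE; apply: (imulA (N := maxn N i.+1)) => j k.
rewrite !geq_max => /orP[/andP[_ ij]|/andP[Nk _]].
  by rewrite lA// !mul0r.
by rewrite xN ?mulr0.
Qed.

(** The support of x bounds k, and upper triangularity of [B] then bounds j by k. *)
Lemma iapp_imul_upper_fs A B (x : nat -> R) :
  lower_triangular (itr B) -> finitely_supported x ->
  iapp A (iapp B x) = iapp (imul A B) x.
Proof.
move=> uB [N _ xN]; apply/funext => i.
rewrite (iappE A) [in RHS]iappE; apply: (imulA (N := N)) => j k.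
have [Nk _|kN] := leqP N k; first by rewrite xN ?mulr0.
by rewrite orbF => Nj; rewrite [B j k]uB ?mulr0 ?mul0r// (leq_trans kN).
Qed.

(** [iapp A x] need not be finitely supported, so the factors are cancelled one by one from the
    middle: Z^T L = I, then D^-1 D = I, then Z L^T = I. *)
Lemma inverse_cholesky A L Z (d : nat -> R) :
  cholesky A L d -> lower_triangular (itr Z) -> inverse_of (itr L) Z ->
  forall x, finitely_supported x ->
    iapp Z (iapp (idiag (fun k => (d k)^-1)) (iapp (itr Z) (iapp A x))) = x.
Proof.
move=> [[_ lL] d_gt0 AE] uZ [LZ ZL] x fx.
have ZtL : imul (itr Z) L = iid by rewrite -itr_iid -LZ itr_imul.
have DLx : iapp (imul (idiag d) (itr L)) x = fun i => d i * iapp (itr L) x i.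
  rewrite -iapp_imul_lower_fs ?iapp_diag// => m n mn.
  by rewrite /idiag ltn_eqF.
rewrite AE -iapp_imul_lower_fs// (iapp_imul_lower _ uZ lL) ZtL iapp1.
rewrite DLx iapp_diag.
under [X in iapp Z X]eq_fun => i do rewrite mulrA mulVf ?mul1r ?gt_eqF//.
by rewrite iapp_imul_upper_fs// ZL iapp1.
Qed.

(** Transposing U L^T = I makes [itr U], like [W], a right inverse of [L]; both then agree with the
    triangular left inverse [itr Z]. *)
Lemma qform_inverse_unique L Z U W (d : nat -> R) :
  lower_triangular L -> lower_triangular (itr Z) ->
  inverse_of (itr L) Z -> inverse_of (itr L) U -> inverse_of L W ->
  qform U d W = qform Z d (itr Z).
Proof.
move=> lL uZ [LZ ZL] [_ UL] [LW _].
have ZtL : imul (itr Z) L = iid by rewrite -itr_iid -LZ itr_imul.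
have -> : W = itr Z by exact: (lower_right_inverse_unique lL).
have -> // : U = Z.
rewrite -[U]/(itr (itr U)) -[RHS]/(itr (itr Z)); congr itr.
apply: (lower_right_inverse_unique lL) => //.
by rewrite -itr_iid -UL itr_imul.
Qed.

End InfiniteMatrixTheory.

(** * Heat polynomials and the Fischer form *)

Section HeatPolynomials.
Variable R : realType.
Implicit Types (s : R) (p q : {poly R}).

(* [heat s n] is exp ((s / 2) (d/dX)^2) applied to X^n. *)
Fixpoint heat s (n : nat) : {poly R} :=
  if n is n'.+1 then 'X * heat s n' + s *: (heat s n')^`() else 1.

Lemma coef_heatS s n k : (heat s n.+1)`_k =
  (if k == 0%N then 0 else (heat s n)`_k.-1) + s * ((heat s n)`_k.+1 *+ k.+1).
Proof. by rewrite /= coefD coefZ coef_deriv coefXM. Qed.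

(** The j-th term of the exponential series sends X^n to (s/2)^j / j! * n! / (n-2j)! X^(n-2j), the
    term of degree k = n - 2j. *)
Lemma coef_heat s n : let P := heat s n in
  (forall j k, n = (k + j.*2)%N ->
     P`_k = n`!%:R / k`!%:R * (s / 2) ^+ j / j`!%:R) /\
  (forall k, (n < k)%N || odd (n + k) -> P`_k = 0).
Proof.
have fact_neq0 m : (m`!%:R : R) != 0 by rewrite pnatr_eq0 -lt0n fact_gt0.
elim: n => [|n [IHe IHz]] /=.
  split=> [j k /esym/eqP|k]; last by case: k => [|k] // _; rewrite coef1.
  rewrite addn_eq0 double_eq0 => /andP[/eqP-> /eqP->].
  by rewrite coef1 expr0 fact0 mulr1 !divr1.
split=> [j k|k nk]; rewrite coef_heatS; last first.
  rewrite [X in s * (X *+ _)]IHz ?mul0rn ?mulr0 ?addr0; last first.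
    case/orP: nk => [nk|]; first by rewrite ltnW ?orTb//; apply: ltnW.
    by rewrite addnS /= => ->; rewrite orbT.
  case: k nk => [|k] nk; [by []|]; rewrite IHz//.
  by move: nk; rewrite ltnS addnS /= negbK.
case: j => [|j] nE.
  move: nE; rewrite addn0; case: k => [//|k [nk]].
  rewrite [X in s * (X *+ _)]IHz ?mul0rn ?mulr0 ?addr0 /=; last first.
    by rewrite nk leqnSn.
  by rewrite (IHe 0%N k) ?nk ?addn0// expr0 !divff// divr1.
have nE' : n = (k.+1 + j.*2)%N.
  by move: nE; rewrite doubleS !addnS => -[->]; rewrite addSn.
rewrite [X in s * (X *+ _)](IHe _ _ nE').
have k_neq0 : (k.+1%:R : R) != 0 by rewrite pnatr_eq0.
have j_neq0 : (j.+1%:R : R) != 0 by rewrite pnatr_eq0.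
(* The two terms of the recursion add up to a common factor times k + 2 (j + 1), which is n + 1. *)
have nR : (n.+1%:R : R) = k%:R + 2 * j.+1%:R.
  by rewrite nE natrD doubleS -doubleS -mul2n natrM.
case: k nE nE' k_neq0 nR => [|k] nE nE' k_neq0 nR /=.
  rewrite add0r !factS !natrM nR !add0r exprS !fact0 mulr1n.
  move: (fact_neq0 j) j_neq0; move: (j`!%:R : R) (j.+1%:R : R) => F J F0 J0.
  by field; rewrite F0 J0.
rewrite (IHe j.+1 k); last by rewrite nE' doubleS !addSn !addnS.
have k1_neq0 : (k.+1%:R : R) != 0 by rewrite pnatr_eq0.
rewrite !factS !natrM nR -[X in _ + s * X]mulr_natr exprS.
move: (fact_neq0 j) (fact_neq0 k) j_neq0 k_neq0 k1_neq0.
move: (j`!%:R : R) (k`!%:R : R) (j.+1%:R : R) (k.+1%:R : R) (k.+2%:R : R).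
move=> F G J K K' F0 G0 J0 K'0 K0.
by field; rewrite F0 G0 J0 K0 K'0.
Qed.

Lemma coef_heat_cond s n k : (heat s n)`_k =
  if (k <= n)%N && ~~ odd (n - k) then
    n`!%:R / k`!%:R * (s / 2) ^+ (n - k)./2 / ((n - k)./2)`!%:R
  else 0.
Proof.
have [even_case odd_case] := coef_heat s n.
have [kn|nk] /= := leqP k n; last by rewrite odd_case ?nk.
case: ifPn => [even|/negPn odd_nk].
  by rewrite (even_case (n - k)./2)// even_halfK// subnKC.
by rewrite odd_case// oddD -oddB// odd_nk orbT.
Qed.

Lemma coef_heat_gt s n k : (n < k)%N -> (heat s n)`_k = 0.
Proof. by move=> nk; rewrite coef_heat_cond leqNgt nk. Qed.

Lemma deriv_heat s n : (heat s n.+1)^`() = heat s n *+ n.+1.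
Proof.
elim: n => [|n IH]; first by rewrite /= derivC scaler0 addr0 mulr1 derivX.
rewrite [heat s n.+2]/= -/(heat s n.+1) derivD derivM derivX mul1r derivZ IH.
rewrite derivMn -scalerMnr mulrnAr -addrA -mulrnDl.
by rewrite [in RHS]mulrS.
Qed.

(** exp ((s / 2) (d/dX)^2) on all polynomials, extended linearly from the powers of X. *)
Definition heat_op s p := \sum_(j < size p) p`_j *: heat s j.

Lemma heat_opE N s p : (size p <= N)%N ->
  heat_op s p = \sum_(j < N) p`_j *: heat s j.
Proof.
move=> pN; rewrite /heat_op.
rewrite (big_ord_widen _ (fun j => p`_j *: heat s j) pN) big_mkcond /=.
apply: eq_bigr => j _; case: ltnP => // pj.
by rewrite nth_default ?scale0r.
Qed.

Lemma heat_opD s c p q :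
  heat_op s (p + c *: q) = heat_op s p + c *: heat_op s q.
Proof.
pose N := maxn (size (p + c *: q)) (maxn (size p) (size q)).
rewrite !(@heat_opE N) ?leq_max ?leqnn ?orbT//.
rewrite scaler_sumr -big_split; apply: eq_bigr => j _ /=.
by rewrite coefD coefZ scalerDl scalerA.
Qed.

Lemma deriv_heat_op s p : (heat_op s p)^`() = heat_op s p^`().
Proof.
rewrite (@heat_opE (size p).+1)// (@heat_opE (size p)); last first.
  by rewrite (leq_trans (size_poly _ _)) ?leq_pred.
rewrite (raddf_sum deriv) big_ord_recl /= derivZ derivC scaler0 add0r.
apply: eq_bigr => j _; rewrite /bump add1n derivZ deriv_heat coef_deriv.
by rewrite -scalerMnr scalerMnl.
Qed.

(** The commutator of exp ((s / 2) (d/dX)^2) with X is s (d/dX) exp ((s / 2) (d/dX)^2); on powers of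
    X this is the recursion defining [heat]. *)
Lemma heat_opXM s p :
  heat_op s ('X * p) = 'X * heat_op s p + s *: (heat_op s p)^`().
Proof.
rewrite (@heat_opE (size p).+1); last first.
  by rewrite (leq_trans (size_polyMleq _ _))// size_polyX.
rewrite big_ord_recl coefXM scale0r add0r /heat_op.
rewrite (raddf_sum deriv) scaler_sumr mulr_sumr -big_split.
apply: eq_bigr => j _; rewrite coefXM /= derivZ scalerDr -scalerAr.
by rewrite !scalerA (mulrC s).
Qed.

(** In the induction the derivative term produced by [heat_opXM] cancels the one in the recursion
    for [heat (- s)]. *)
Lemma heat_op_heatN s n : heat_op s (heat (- s) n) = 'X^n.
Proof.
elim: n => [|n IH].
  by rewrite /= /heat_op size_poly1 big_ord1 coefC scale1r.
rewrite [heat _ _]/= heat_opD heat_opXM -deriv_heat_op IH.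
by rewrite exprS scaleNr addrK.
Qed.

(** Row n expands [heat s n] / sqrt (n!) in the basis X^k / sqrt (k!). *)
Definition heat_mx s : imatrix R :=
  fun n k => (heat s n)`_k * Num.sqrt (k`!%:R / n`!%:R).

Lemma heat_mx_lower s : lower_triangular (heat_mx s).
Proof. by move=> n k nk; rewrite /heat_mx coef_heat_gt ?mul0r. Qed.

(** Up to normalisation, row n of the product holds the coefficients of [heat_op (- s) (heat s n)],
    which is X^n; the square-root factors telescope. *)
Lemma heat_mx_inverse s : imul (heat_mx s) (heat_mx (- s)) = iid.
Proof.
apply/funext => n; apply/funext => k.
rewrite (imulE (N := n.+1)); last first.
  by move=> j nj; rewrite heat_mx_lower ?mul0r.
transitivity (Num.sqrt (k`!%:R / n`!%:R) *
    (heat_op (- s) (heat s n))`_k); last first.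
  rewrite -{2}[s]opprK heat_op_heatN coefXn /iid /idiag.
  have [->|kn] := eqVneq k n; last by rewrite mulr0.
  by rewrite mulr1 divff ?sqrtr1// pnatr_eq0 -lt0n fact_gt0.
rewrite (@heat_opE n.+1); last first.
  by apply/leq_sizeP => j; exact: coef_heat_gt.
rewrite coef_sum mulr_sumr; apply: eq_bigr => j _.
rewrite coefZ /heat_mx.
have -> : Num.sqrt (k`!%:R / n`!%:R) =
    Num.sqrt (j`!%:R / n`!%:R) * Num.sqrt (k`!%:R / j`!%:R) :> R.
  rewrite -sqrtrM ?divr_ge0 ?ler0n//; congr Num.sqrt.
  by field; rewrite !pnatr_eq0 -!lt0n !fact_gt0.
by ring.
Qed.

(* For this symmetric form multiplication by X is adjoint to [- s] times the
   derivative. *)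
Definition fischer s p q :=
  \sum_(k < size p) p`_k * q`_k * (k`!%:R * (- s) ^+ k).

Lemma fischerE N s p q : (size p <= N)%N ->
  fischer s p q = \sum_(k < N) p`_k * q`_k * (k`!%:R * (- s) ^+ k).
Proof.
move=> pN; rewrite /fischer.
rewrite (big_ord_widen _ (fun k => p`_k * q`_k * (k`!%:R * (- s) ^+ k)) pN).
rewrite big_mkcond /=.
apply: eq_bigr => j _; case: ltnP => // pj.
by rewrite nth_default ?mul0r.
Qed.

Lemma fischerC s p q : fischer s p q = fischer s q p.
Proof.
rewrite !(@fischerE (maxn (size p) (size q))) ?leq_max ?leqnn ?orbT//.
by apply: eq_bigr => k _; rewrite (mulrC p`_k).
Qed.

Lemma fischerDr s c p q1 q2 :
  fischer s p (q1 + c *: q2) = fischer s p q1 + c * fischer s p q2.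
Proof.
rewrite /fischer mulr_sumr -big_split; apply: eq_bigr => k _ /=.
by rewrite coefD coefZ; ring.
Qed.

Lemma fischerDl s c p1 p2 q :
  fischer s (p1 + c *: p2) q = fischer s p1 q + c * fischer s p2 q.
Proof. by rewrite fischerC fischerDr !(fischerC s q). Qed.

Lemma fischerXM s p q : fischer s ('X * p) q = - s * fischer s p q^`().
Proof.
rewrite (@fischerE (size p).+1); last first.
  by rewrite (leq_trans (size_polyMleq _ _))// size_polyX.
rewrite big_ord_recl coefXM !mul0r add0r /fischer mulr_sumr.
apply: eq_bigr => k _; rewrite coefXM coef_deriv /= /bump /= add1n.
by rewrite factS natrM exprS -mulr_natr; ring.
Qed.

(** By adjointness both sides equal s (<P_m', P_n> - <P_m, P_n'>), with P_n = [heat s n]. *)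
Lemma fischer_heatS s m n :
  fischer s (heat s m.+1) (heat s n) = - fischer s (heat s m) (heat s n.+1).
Proof.
rewrite [heat s m.+1]/= [heat s n.+1]/= fischerDl fischerDr fischerXM.
rewrite [fischer s (heat s m) ('X * _)]fischerC fischerXM.
by rewrite (fischerC s (heat s n)); ring.
Qed.

Lemma fischer_heat0 s n : fischer s (heat s 0) (heat s n) = (heat s n)`_0.
Proof.
by rewrite /fischer size_poly1 big_ord1 coefC mul1r fact0 expr0 mulr1 mulr1.
Qed.

(** Pairing with 1 reads off the constant coefficient; that of [heat s n.+2] is s times the linear
    coefficient of [heat s n.+1], known from [deriv_heat]. *)
Lemma fischer_heat0SS s n :
  fischer s (heat s 0) (heat s n.+2) =
  s * n.+1%:R * fischer s (heat s 0) (heat s n).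
Proof.
rewrite !fischer_heat0 coef_heatS eqxx add0r mulr1n.
have := congr1 (fun p : {poly R} => p`_0) (deriv_heat s n).
by rewrite coef_deriv coefMn mulr1n => ->; rewrite -mulrA mulr_natl.
Qed.

(** * Hermite polynomials under an abstract Gaussian functional *)

Lemma deriv_hermite n : (hermite R n.+1)^`() = hermite R n *+ (2 * n.+1).
Proof.
elim: n => [|n IH].
  rewrite /= derivC subr0 mulr1 derivM derivC mul0r add0r derivX mulr1.
  by rewrite polyCMn.
rewrite [hermite R n.+2]/= -/(hermite R n.+1) derivB derivM IH derivMn.
rewrite derivM derivC derivX mul0r add0r mulr1 [in RHS]mulnS mulrnDr.
rewrite mulrnAr -addrA -mulrnBl; congr (_ + _).
by rewrite mul_polyC scaler_nat.
Qed.

Variable Lam : {poly R} -> R.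
Hypothesis LamD : forall c p q, Lam (c *: p + q) = c * Lam p + Lam q.
Hypothesis Lam_ibp : forall p, Lam (4%:P * 'X * p - p^`()) = 0.

(** Induction on m shifts all the degree to the second factor, where a two-step induction on n
    concludes. The factor sqrt 2 ^ (m + n) is constant under the shift, and its gain of 2 per double
    step turns the Fischer factor - (n + 1) / 2 into the Hermite factor - (n + 1). *)
Lemma gaussian_hermite m n :
  Lam (hermite R m * hermite R n) =
  Lam 1 * Num.sqrt 2 ^+ (m + n) *
  fischer (- 2^-1) (heat (- 2^-1) m) (heat (- 2^-1) n).
Proof.
have Lam0 : Lam 0 = 0.
  by have := LamD (-1) 0 0; rewrite scaler0 addr0 mulN1r addNr.
have LamZ c p : Lam (c *: p) = c * Lam p.
  by rewrite -[c *: p]addr0 LamD Lam0 addr0.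
have C2 : 2%:P = 2 :> {poly R} by rewrite polyCMn.
have C4 : 4%:P = 4 :> {poly R} by rewrite polyCMn.
elim: m n => [|m IH] n; last first.
  rewrite fischer_heatS addSnnS mulrN -IH; apply/eqP; rewrite -addr_eq0.
  rewrite -[Lam (_ * _)]mul1r -LamD scale1r.
  (* H_(m+1) H_n + H_m H_(n+1) = 4 X p - p' for p = H_m H_n. *)
  rewrite -[X in _ == X](Lam_ibp (hermite R m * hermite R n)).
  by apply/eqP; congr Lam; rewrite /= derivM C2 C4; ring.
rewrite mul1r add0n; elim/ltn_ind: n => -[_|[_|n IH]].
- by rewrite fischer_heat0 coefC expr0 !mulr1.
- rewrite fischer_heat0 coef_heatS eqxx add0r coef1 mul0rn !mulr0.
  rewrite (_ : hermite R 1 = 2^-1 *: (4%:P * 'X * 1 - 1^`())).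
    by rewrite LamZ Lam_ibp mulr0.
  rewrite /= derivC !subr0 !mulr1 -mul_polyC mulrA -polyCM; congr (_%:P * _).
  by field.
(* With H = H_(n+1), 2 X H - H' = (4 X H - H') / 2 - H' / 2, and H' = 2 (n + 1) H_n. *)
rewrite fischer_heat0SS (_ : hermite R n.+2 =
  2^-1 *: (4%:P * 'X * hermite R n.+1 - (hermite R n.+1)^`()) +
  (- n.+1%:R) *: hermite R n).
  rewrite LamD Lam_ibp mulr0 add0r LamZ IH// [in RHS]exprS [in RHS]exprS.
  have -> (x : R) : Lam 1 * (Num.sqrt 2 * (Num.sqrt 2 * x)) =
     Lam 1 * x * Num.sqrt 2 ^+ 2 by ring.
  by rewrite sqr_sqrtr ?ler0n//; field.
rewrite [LHS]/= -/(hermite R n.+1) deriv_hermite.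
set h1 := hermite R n.+1; set h0 := hermite R n.
rewrite -!mul_polyC polyCN (polyCMn n.+1) C2 C4 -[h0 *+ _]mulr_natl natrM.
have half2 : (2^-1)%:P * 2 = 1 :> {poly R}.
  by rewrite -C2 -polyCM mulVf ?pnatr_eq0.
transitivity ((2^-1)%:P * 2 * (2 * 'X * h1 - n.+1%:R * h0) - n.+1%:R * h0).
  by rewrite half2; ring.
by ring.
Qed.

End HeatPolynomials.

(** * Gaussian integrals of polynomials *)

Section GaussianIntegrals.
Variable R : realType.
Implicit Types (a b : R) (p : {poly R}).

Notation mu := (@lebesgue_measure R).

Definition poly_gauss p a (v : R) := p.[v] * expR (- (a * v ^+ 2)).

Lemma continuous_poly_gauss p a : continuous (poly_gauss p a).
Proof.
move=> v; apply: cvgM; first exact: continuous_horner.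
apply: (cvg_comp _ expR); last exact: continuous_expR.
apply: cvgN; apply: cvgM; first exact: cvg_cst.
exact: sqr_continuous.
Qed.

Lemma measurable_poly_gauss p a : measurable_fun setT (poly_gauss p a).
Proof. exact: continuous_measurable_fun (@continuous_poly_gauss p a). Qed.

(** The weight is a rescaled normal density of variance 1 / (2 a); integrability and total mass are
    inherited from it. *)
Lemma gauss_rescale a v : 0 < a -> let s := Num.sqrt (2 * a)^-1 in
  poly_gauss 1 a v = (normal_peak s)^-1 * normal_pdf 0 s v.
Proof.
move=> a_gt0 s.
have a2_gt0 : 0 < (2 * a)^-1 by rewrite invr_gt0 mulr_gt0.
have s_neq0 : s != 0 by rewrite gt_eqF// sqrtr_gt0.
rewrite normal_pdfE// mulrA mulVf ?mul1r ?gt_eqF ?normal_peak_gt0//.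
rewrite /poly_gauss hornerC mul1r /normal_fun subr0 sqr_sqrtr ?ltW//.
by congr expR; field; rewrite gt_eqF.
Qed.

Lemma integrable_gauss a : 0 < a -> mu.-integrable setT (EFin \o poly_gauss 1 a).
Proof.
move=> a_gt0; set s := Num.sqrt (2 * a)^-1.
apply: (@eq_integrable _ _ _ mu _ measurableT
  (fun v => ((normal_peak s)^-1)%:E * (normal_pdf 0 s v)%:E)%E).
  by move=> v _; rewrite /= gauss_rescale// EFinM.
by apply: integrableZl => //; exact: integrable_normal_pdf.
Qed.

Lemma Rintegral_gauss a : 0 < a ->
  \int[mu]_v poly_gauss 1 a v = Num.sqrt (pi / a).
Proof.
move=> a_gt0; under eq_Rintegral do rewrite gauss_rescale//.
set s := Num.sqrt (2 * a)^-1.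
rewrite RintegralZl//; last exact: integrable_normal_pdf.
rewrite /Rintegral integral_normal_pdf mulr1 invrK.
rewrite sqr_sqrtr ?invr_ge0 ?mulr_ge0 ?ltW//; congr Num.sqrt.
by field; rewrite gt_eqF.
Qed.

(** A single term (b y)^n / n! of the exponential series is at most exp (b y). *)
Lemma expR_mul_exprn_bounded b n (y : R) : 0 < b -> 0 <= y ->
  y ^+ n * expR (- (b * y)) <= n`!%:R / b ^+ n.
Proof.
move=> b_gt0 y_ge0; rewrite expRN ler_pdivrMr ?expR_gt0//.
rewrite mulrAC ler_pdivlMr ?exprn_gt0// -exprMn (mulrC y) [leRHS]mulrC.
rewrite -ler_pdivrMr ?ltr0n ?fact_gt0//.
have by_ge0 : 0 <= b * y by rewrite mulr_ge0// ltW.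
case: n => [|n]; first by rewrite fact0 divr1 expr0 -expR0 ler_expR.
by apply: le_trans (expR_ge1Dxn n by_ge0); rewrite lerDr.
Qed.

Lemma poly_gauss_bounded p b : 0 < b ->
  exists C, forall v, `|poly_gauss p b v| <= C.
Proof.
move=> b_gt0.
(* The 1 covers |v| <= 1; for |v| > 1, |v|^i <= (v^2)^i and the exponential bound applies with y =
   v^2. *)
exists (\sum_(i < size p) `|p`_i| * (1 + i`!%:R / b ^+ i)) => v.
rewrite /poly_gauss horner_coef mulr_suml (le_trans (ler_norm_sum _ _ _))//.
apply: ler_sum => i _; rewrite !normrM -mulrA ler_wpM2l//.
rewrite [`|expR _|]ger0_norm ?expR_ge0//.
have le1 : expR (- (b * v ^+ 2)) <= 1.
  by rewrite expR_le1 oppr_le0 mulr_ge0 ?sqr_ge0// ltW.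
have := @expR_mul_exprn_bounded b i (v ^+ 2) b_gt0 (sqr_ge0 _).
have [v1 _|v1 bnd] := lerP `|v| 1.
  rewrite (@le_trans _ _ 1)//.
    by rewrite mulr_ile1 ?expR_ge0// normrX exprn_ile1.
  by rewrite lerDl divr_ge0 ?ler0n ?exprn_ge0// ltW.
rewrite -[leLHS]add0r lerD// (le_trans _ bnd)// ler_wpM2r ?expR_ge0//.
rewrite normrX -[v ^+ 2]ger0_norm ?sqr_ge0// normrX.
by rewrite lerXn2r ?nnegrE ?exprn_ge0// expr2 ler_peMl// ltW.
Qed.

(** Half of the exponent keeps the polynomial bounded; the other half is an integrable Gaussian. *)
Lemma integrable_poly_gauss p a : 0 < a ->
  mu.-integrable setT (EFin \o poly_gauss p a).
Proof.
move=> a_gt0; have a2_gt0 : 0 < a / 2 by rewrite divr_gt0.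
have [C pC] := poly_gauss_bounded p a2_gt0.
apply: (@le_integrable _ _ _ mu _ measurableT _
  (fun v => C%:E * (poly_gauss 1 (a / 2) v)%:E)%E).
- apply/measurable_EFinP; exact: measurable_poly_gauss.
- move=> v _; rewrite -EFinM /= lee_fin.
  have -> : poly_gauss p a v = poly_gauss p (a / 2) v * poly_gauss 1 (a / 2) v.
    rewrite /poly_gauss hornerC mul1r -mulrA -expRD.
    by congr (_ * expR _); field.
  by rewrite normrM [leRHS]normrM ler_wpM2r// (le_trans (pC v))// ler_norm.
- by apply: integrableZl => //; exact: integrable_gauss.
Qed.

Lemma poly_gauss_le_inv p a : 0 < a ->
  exists C, forall v, `|v| * `|poly_gauss p a v| <= C.
Proof.
move=> a_gt0; have [C pC] := poly_gauss_bounded ('X * p) a_gt0.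
exists C => v; rewrite -normrM; have := pC v.
by rewrite /poly_gauss hornerM hornerX -mulrA.
Qed.

(** The condition on |u n| serves both ends of the line, u n = n and u n = - n. *)
Lemma cvg_poly_gauss p a (u : R^nat) : 0 < a -> (forall n, `|u n| = n%:R) ->
  poly_gauss p a (u n) @[n --> \oo] --> (0 : R).
Proof.
move=> a_gt0 un; have [C pC] := poly_gauss_le_inv p a_gt0.
apply/cvgr0Pnorm_le => e e_gt0; near=> n.
have n_gt0 : 0 < n%:R :> R by near: n; exact: nbhs_infty_gtr.
rewrite -(ler_pM2l n_gt0) (le_trans _ (_ : C <= _))//.
  by rewrite -{1}un.
rewrite -ler_pdivrMr//.
by near: n; exact: nbhs_infty_ger.
Unshelve. all: by end_near. Qed.

(** The fundamental theorem on growing symmetric intervals, then dominated convergence with bound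
    |f|. *)
Lemma Rintegral_setT_FTC2 (f F : R -> R) (l l' : R) :
  continuous f -> mu.-integrable setT (EFin \o f) ->
  (forall x : R, is_derive x 1 F (f x)) ->
  F n%:R @[n --> \oo] --> l -> F (- n%:R) @[n --> \oo] --> l' ->
  \int[mu]_x f x = l - l'.
Proof.
move=> cf intf dF Fl Fl'.
have cF : continuous F.
  by move=> x; apply/differentiable_continuous/derivable1_diffP; case: (dF x).
pose D n : set R := [set` `[- n%:R, n%:R]].
(* The index [n.+1] keeps the interval nondegenerate. *)
have intD n :
    (\int[mu]_(x in D n.+1) (f x)%:E = (F n.+1%:R - F (- n.+1%:R))%:E)%E.
  rewrite EFinB; apply: continuous_FTC2.
  - by rewrite -subr_gt0 opprK addr_gt0.
  - exact: continuous_subspaceT.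
  - split; first by move=> x _; case: (dF x).
      by apply: cvg_at_right_filter; exact: cF.
    by apply: cvg_at_left_filter; exact: cF.
  - by move=> x _; rewrite derive1E; case: (dF x).
have cvg_int : (\int[mu]_x ((EFin \o f) \_ (D n.+1)) x @[n --> \oo] -->
    \int[mu]_x (f x)%:E)%E.
  apply: (@dominated_cvg _ _ _ mu _ measurableT
    (fun n => (EFin \o f) \_ (D n.+1))
    (EFin \o f) (abse \o (EFin \o f))) => //.
  - move=> n; apply/(measurable_restrictT (D := D n.+1)).
      exact: measurable_itv.
    by apply: measurable_funTS; exact: measurable_int intf.
  - move=> x _; apply: cvg_near_cst; near=> n.
    rewrite patchE mem_set// /D /= in_itv/= -ler_norml.
    suff : `|x| <= n%:R by move=> /le_trans; apply; rewrite ler_nat.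
    by near: n; exact: nbhs_infty_ger.
  - exact: integrable_abse.
  - move=> n x _; rewrite patchE; case: ifPn => // _.
    by rewrite abse0 abse_ge0.
have cvgF : F n.+1%:R - F (- n.+1%:R) @[n --> \oo] --> l - l'.
  apply: cvgB; first by rewrite (cvg_shiftS (fun n => F n%:R)).
  by rewrite (cvg_shiftS (fun n => F (- n%:R))).
have cvg_intF : (\int[mu]_x ((EFin \o f) \_ (D n.+1)) x @[n --> \oo] -->
    (l - l')%:E)%E.
  have intDE n : (\int[mu]_x ((EFin \o f) \_ (D n.+1)) x =
      (F n.+1%:R - F (- n.+1%:R))%:E)%E.
    by rewrite -integral_mkcond -intD.
  apply: cvg_EFin; first by apply: nearW => n; rewrite intDE.
  by under eq_fun do rewrite /= intDE.
by rewrite /Rintegral (cvg_unique _ cvg_int cvg_intF).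
Unshelve. all: by end_near. Qed.

Lemma is_derive_poly_gauss p a (v : R) :
  is_derive v 1 (poly_gauss p a) (poly_gauss (p^`() - (2 * a)%:P * 'X * p) a v).
Proof.
have -> : poly_gauss p a = horner p * (expR \o horner (- (a%:P * 'X^2))).
  apply/funext => x; rewrite /poly_gauss fctE /=. by rewrite !hornerE.
apply: is_derive_eq.
rewrite /poly_gauss /= derivN derivM derivC mul0r add0r derivXn /= !hornerE /=.
by rewrite /GRing.scale /=; ring.
Qed.

Lemma Rintegral_deriv_poly_gauss p a : 0 < a ->
  \int[mu]_v poly_gauss (p^`() - (2 * a)%:P * 'X * p) a v = 0.
Proof.
move=> a_gt0; rewrite -[RHS](subr0 0).
apply: (@Rintegral_setT_FTC2 _ (poly_gauss p a)).
- exact: continuous_poly_gauss.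
- exact: integrable_poly_gauss.
- exact: is_derive_poly_gauss.
- by apply: cvg_poly_gauss => // n; rewrite normr_nat.
- by apply: cvg_poly_gauss => // n; rewrite normrN normr_nat.
Qed.

End GaussianIntegrals.

(** * The Gram matrix *)

Section GramMatrix.
Variable R : realType.

Notation mu := (@lebesgue_measure R).

Lemma heat_mxE (s : R) n m : heat_mx s n m =
  if (m <= n)%N && ~~ odd (n - m) then
    (s / 2) ^+ (n - m)./2 * Num.sqrt (n`!%:R / m`!%:R) / ((n - m)./2)`!%:R
  else 0.
Proof.
rewrite /heat_mx coef_heat_cond; case: ifP => _; last by rewrite mul0r.
have sqrt_gt0 k : 0 < Num.sqrt k`!%:R :> R by rewrite sqrtr_gt0 ltr0n fact_gt0.
have sqrtE k l :
    Num.sqrt (k`!%:R / l`!%:R) = Num.sqrt k`!%:R / Num.sqrt l`!%:R :> R.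
  by rewrite sqrtrM ?ler0n// sqrtrV ?ler0n.
have factE k : k`!%:R = Num.sqrt k`!%:R ^+ 2 :> R by rewrite sqr_sqrtr ?ler0n.
rewrite !sqrtE; move: (factE n) (factE m) (sqrt_gt0 n) (sqrt_gt0 m).
move: (Num.sqrt n`!%:R) (Num.sqrt m`!%:R) => x y -> -> x0 y0.
have := fact_gt0 (n - m)./2; rewrite -(ltr0n R).
move: (_`!%:R : R) => z z0.
by field; rewrite !gt_eqF.
Qed.

(** Here s / 2 = - 1/4, whose powers give both the sign and the 4^j. *)
Lemma gram_LE : gram_L R = heat_mx (- 2^-1).
Proof.
apply/funext => n; apply/funext => m; rewrite heat_mxE /gram_L.
case: ifP => // _; rewrite invfM mulrA; congr (_ / _).
rewrite mulrAC; congr (_ * _).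
by rewrite -exprVn -exprMn; congr (_ ^+ _); field.
Qed.

Lemma gram_kernelE : gram_kernel R = itr (heat_mx 2^-1).
Proof.
apply/funext => m; apply/funext => n; rewrite /itr heat_mxE /gram_kernel.
case: ifP => // _; rewrite invfM mulrA; congr (_ / _).
rewrite mulrC; congr (_ * _).
by rewrite -exprVn; congr (_ ^+ _); field.
Qed.

Lemma gram_DE k : gram_D R k = 2^-1 ^+ k / Num.sqrt 2.
Proof.
rewrite /gram_D powRD; last by apply/implyP => _; rewrite pnatr_eq0.
by rewrite !powRN powR_mulrn// -powR12_sqrt// exprVn.
Qed.

Section GramEntries.
Variable T : R.
Hypothesis T_gt0 : 0 < T.

Let k := (Num.sqrt T)^-1.

Let sqrtT_gt0 : 0 < Num.sqrt T. Proof. by rewrite sqrtr_gt0. Qed.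

Let a_gt0 : 0 < 2 / T. Proof. by rewrite divr_gt0. Qed.

(** The scaling u = v / sqrt T is put into the polynomial, so no change of variables in the integral
    is required; 2 / T comes from the product of two weights exp (- v^2 / T). *)
Let Lam (q : {poly R}) := \int[mu]_v poly_gauss (q \Po (k *: 'X)) (2 / T) v.

Let LamD (c : R) (p q : {poly R}) : Lam (c *: p + q) = c * Lam p + Lam q.
Proof.
rewrite /Lam -RintegralZl//; last exact: integrable_poly_gauss.
rewrite -RintegralD//; last 2 first.
- apply: (eq_integrable measurableT _ _ _
    (integrable_poly_gauss (c *: p \Po (k *: 'X)) a_gt0)).
  by move=> v _; rewrite /= /poly_gauss comp_polyZ hornerZ -mulrA.
- exact: integrable_poly_gauss.
apply: eq_Rintegral => v _.
by rewrite /poly_gauss comp_polyD comp_polyZ hornerD hornerZ; ring.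
Qed.

Let Lam_ibp (p : {poly R}) : Lam (4%:P * 'X * p - p^`()) = 0.
Proof.
pose q := p \Po (k *: 'X).
(* The factor - k^-1 undoes the chain rule, q'(v) = k p'(k v), and T = k^-2 matches the linear
   terms. *)
have -> : Lam (4%:P * 'X * p - p^`()) =
    \int[mu]_v (- k^-1 *
      poly_gauss (q^`() - (2 * (2 / T))%:P * 'X * q) (2 / T) v).
  apply: eq_Rintegral => v _; rewrite /poly_gauss [RHS]mulrA; congr (_ * _).
  rewrite /q deriv_comp derivZ derivX.
  rewrite comp_polyB !comp_polyM comp_polyX comp_polyC.
  rewrite !hornerE /=.
  rewrite -[T in _ / T]sqr_sqrtr ?ltW// /k.
  by field; rewrite gt_eqF.
rewrite RintegralZl//; last exact: integrable_poly_gauss.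
by rewrite Rintegral_deriv_poly_gauss// mulr0.
Qed.

(** The normalisations of psi_m and psi_n cancel sqrt 2 ^ (m + n) and the sqrt (pi T) of [Lam 1] =
    sqrt (pi T) / sqrt 2, hence the independence of T. *)
Lemma gram_fischer m n : gram T m n =
  fischer (- 2^-1) (heat (- 2^-1) m) (heat (- 2^-1) n)
  / (Num.sqrt m`!%:R * Num.sqrt n`!%:R * Num.sqrt 2).
Proof.
pose c n : R := (2 ^+ n * n`!%:R * Num.sqrt (pi * T)) `^ (- 2^-1).
have piT_gt0 : 0 < pi * T by rewrite mulr_gt0// pi_gt0.
have cE j : c j =
    (Num.sqrt 2 ^+ j * Num.sqrt j`!%:R * Num.sqrt (Num.sqrt (pi * T)))^-1.
  rewrite /c powRN powR12_sqrt; last by rewrite !mulr_ge0 ?exprn_ge0 ?ler0n.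
  congr _^-1; rewrite (sqrtrM (Num.sqrt (pi * T))) ?mulr_ge0 ?exprn_ge0 ?ler0n//.
  rewrite (sqrtrM j`!%:R) ?exprn_ge0//; congr (_ * _ * _).
  elim: j => [|j IH]; first by rewrite !expr0 sqrtr1.
  by rewrite !exprS sqrtrM ?ler0n// IH.
have -> : gram T m n = c m * c n * Lam (hermite R m * hermite R n).
  rewrite /Lam -RintegralZl//; last exact: integrable_poly_gauss.
  apply: eq_Rintegral => v _; rewrite /psi -/(c m) -/(c n) /poly_gauss.
  rewrite comp_polyM hornerM !horner_comp hornerZ hornerX -[k * v]mulrC.
  have -> : expR (- (2 / T * v ^+ 2)) =
      expR (- (v ^+ 2 / T)) * expR (- (v ^+ 2 / T)).
    by rewrite -expRD; congr expR; field; rewrite gt_eqF.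
  by ring.
rewrite (gaussian_hermite LamD Lam_ibp).
have -> : Lam 1 = Num.sqrt (pi * T) / Num.sqrt 2.
  rewrite /Lam -[1 \Po _]/(polyC 1 \Po _) comp_polyC Rintegral_gauss//.
  rewrite -sqrtrV// -sqrtrM ?ltW//.
  by congr Num.sqrt; field; rewrite gt_eqF.
rewrite !cE exprD.
have P_gt0 : 0 < Num.sqrt (Num.sqrt (pi * T)) by rewrite !sqrtr_gt0.
(* Writing sqrt (pi T) as P^2 leaves an identity of rational functions for [field]. *)
have := @sqr_sqrtr _ (Num.sqrt (pi * T)) (sqrtr_ge0 _).
move: (Num.sqrt (Num.sqrt _)) P_gt0 => P P_gt0 <-.
have r_gt0 : 0 < Num.sqrt 2 :> R by rewrite sqrtr_gt0.
have rm_gt0 := exprn_gt0 m r_gt0; have rn_gt0 := exprn_gt0 n r_gt0.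
have fact_sqrt_gt0 j : 0 < Num.sqrt j`!%:R :> R.
  by rewrite sqrtr_gt0 ltr0n fact_gt0.
have m_gt0 := fact_sqrt_gt0 m; have n_gt0 := fact_sqrt_gt0 n.
by field; rewrite !gt_eqF.
Qed.

End GramEntries.

(** The Fischer weight j! / 2^j splits: 1 / 2^j joins 1 / sqrt 2 to form [gram_D], and each copy of
    L takes a factor sqrt (j!). *)
Lemma gram_cholesky (T : R) : 0 < T -> cholesky (gram T) (gram_L R) (@gram_D R).
Proof.
move=> T_gt0; rewrite gram_LE; split.
- split; last exact: heat_mx_lower.
  move=> i; rewrite heat_mxE leqnn subnn/= expr0 mul1r fact0 divr1.
  by rewrite divff ?sqrtr1// pnatr_eq0 -lt0n fact_gt0.
- by move=> k; rewrite /gram_D powR_gt0.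
apply/funext => m; apply/funext => n; rewrite gram_fischer//.
rewrite (imulE (N := m.+1)) => [|j mj]; last by rewrite heat_mx_lower ?mul0r.
rewrite (@fischerE _ m.+1); last by apply/leq_sizeP => j; exact: coef_heat_gt.
rewrite mulr_suml; apply: eq_bigr => j _.
rewrite imul_diag gram_DE /itr /heat_mx opprK.
rewrite !sqrtrM ?ler0n// !sqrtrV ?ler0n//.
have := @sqr_sqrtr R j`!%:R (ler0n _ _).
move: (Num.sqrt j`!%:R) => f <-; rewrite !invfM.
by ring.
Qed.

End GramMatrix.

(* A = L D L^T and Z = (L^T)^{-1}, so that A^{-1} = (L^T)^{-1} D^{-1} L^{-1} makes
   sense; A^{-1} = Z D^{-1} Z^T as quadratic forms on finitely supported
   sequences; and Z D^{-1} Z^T, applied factor by factor, does invert A there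
   (every sum occurring is finite). *)
Theorem lemma3p11 (R : realType) (T : R) (T_gt0 : 0 < T) :
  [/\ cholesky (gram T) (gram_L R) (@gram_D R),
      inverse_of (itr (gram_L R)) (gram_kernel R),
      forall U W : imatrix R,
        inverse_of (itr (gram_L R)) U -> inverse_of (gram_L R) W ->
        forall x : nat -> R, finitely_supported x ->
          qform U (@gram_Dinv R) W x
          = qform (gram_kernel R) (@gram_Dinv R) (itr (gram_kernel R)) x
    & forall x : nat -> R, finitely_supported x ->
        iapp (gram_kernel R) (iapp (idiag (@gram_Dinv R))
          (iapp (itr (gram_kernel R)) (iapp (gram T) x))) = x].
Proof.
have LZ : inverse_of (itr (gram_L R)) (gram_kernel R).
  (* After transposition the two products are [heat_mx_inverse] at s = 1/2 and at s = - 1/2. *)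
  rewrite gram_LE gram_kernelE; split; rewrite -itr_imul.
    by rewrite -[X in heat_mx (- X)]opprK opprK heat_mx_inverse itr_iid.
  by rewrite -[X in imul _ (heat_mx X)]opprK heat_mx_inverse itr_iid.
have chol := gram_cholesky T_gt0.
have lL : lower_triangular (gram_L R) by case: chol => -[].
have uZ : lower_triangular (itr (gram_kernel R)).
  by rewrite gram_kernelE; exact: heat_mx_lower.
split=> // [U W LU LW x _|].
  by rewrite (qform_inverse_unique _ lL uZ LZ LU LW).
exact: inverse_cholesky chol uZ LZ.
Qed.
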